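(* Let $n\ge 1$ be an integer and let $g$ be the out-shuffle permutation of $\{1,2,\dots,2n\}$. The period of the out-shuffle of a deck of $2n$ cards (i.e. the period of $g$) is the smallest integer $s\ge 1$ such that $2^s\equiv 1\pmod{2n-1}$. In other words, it is the order of $2$ modulo $2n-1$.
   Context: A deck of $2n$ cards numbered $1,\dots,2n$ from bottom to top is cut into the packets $1,\dots,n$ and $n+1,\dots,2n$. The out-shuffle interleaves them perfectly, starting with the first packet, giving from bottom to top the cards $1,n+1,2,n+2,\dots,n,2n$. It is described by the permutation $g$ of $\{1,\dots,2n\}$ where $g(i)$ is the number of the card at position $i$ after the shuffle: $g(i)=i/2+n$ if $i$ is even, and $g(i)=(i+1)/2$ if $i$ is odd. The period of a permutation $\sigma$ of a finite set is the smallest integer $s\ge 1$ such that $\sigma^s=\mathrm{id}$ ($s$-fold composition); the period of a shuffle is the period of its permutation. *)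

(* Defs.v *)
From mathcomp Require Import all_boot all_fingroup.
From mathcomp Require Import zify.

Set Implicit Arguments.
Unset Strict Implicit.
Unset Printing Implicit Defensive.

Lemma period_exists (T : finType) (sigma : {perm T}) :
  exists s, (0 < s) && (sigma ^+ s == 1)%g.
Proof. by exists #[sigma]%g; rewrite order_gt0 expg_order eqxx. Qed.

(* The smallest s >= 1 such that sigma^s is the identity. *)
Definition period (T : finType) (sigma : {perm T}) : nat :=
  ex_minn (period_exists sigma).

(* s is the smallest integer s >= 1 such that a^s = 1 modulo m.  This avoids the
   unit group of 'Z_m, which for m = 1 would be that of Z/2. *)
Definition is_mod_order (a m s : nat) : Prop :=
  [/\ 0 < s, a ^ s = 1 %[mod m] &
      forall t, 0 < t -> a ^ t = 1 %[mod m] -> s <= t].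

(* The set {1, ..., 2n}. *)
Definition deck (n : nat) : finType := {i : 'I_(2 * n).+1 | 0 < i}.

(* The number of the card at position i after the shuffle. *)
Definition out_shuffle_nat (n i : nat) : nat :=
  if odd i then i.+1 %/ 2 else i %/ 2 + n.

Lemma out_shuffle_lt n (i : deck n) : out_shuffle_nat n (val (val i)) < (2 * n).+1.
Proof.
case: i => -[i lti] /= i_gt0; rewrite /out_shuffle_nat.
by case: ifP => oddi; lia.
Qed.

Lemma out_shuffle_gt0 n (i : deck n) : 0 < Ordinal (out_shuffle_lt i).
Proof.
case: i => -[i lti] /= i_gt0; rewrite /out_shuffle_nat.
by case: ifP => oddi; lia.
Qed.

Definition out_shuffle_fun (n : nat) (i : deck n) : deck n :=
  Sub (Ordinal (out_shuffle_lt i)) (out_shuffle_gt0 i).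

Lemma out_shuffle_inj n : injective (@out_shuffle_fun n).
Proof.
move=> [[i lti] i_gt0] [[j ltj] j_gt0] /(congr1 (fun k : deck n => val (val k))).
rewrite /= /out_shuffle_nat => eq_ij; do 2 apply: val_inj => /=.
by move: i_gt0 j_gt0 eq_ij => /=; case: ifP => oddi; case: ifP => oddj; lia.
Qed.

Definition out_shuffle (n : nat) : {perm (deck n)} := perm (@out_shuffle_inj n).

(* Main.v *)
Require Import Defs.
From mathcomp Require Import all_boot all_fingroup.
From mathcomp Require Import zify.

(** Counting positions from 0, the shuffle halves them modulo [2n - 1]: if
    [j = g(i)], then [2 (j - 1)] is congruent to [i - 1].  Hence
    [2^t (g^t(i) - 1)] is congruent to [i - 1], and evaluating at [i = 2] shows
    that [g^t = id] forces [2^t = 1] modulo [2n - 1].  Conversely, the residues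
    of [i - 1] determine [i] except that [i = 1] and [i = 2n] collide; this
    ambiguity is resolved because [g] fixes [1]. *)

Definition card_number (n : nat) (i : deck n) : nat := val (val i).

Lemma card_number_inj n : injective (@card_number n).
Proof. by move=> i j eq_ij; do 2 apply: val_inj. Qed.

Lemma card_number_bounds n (i : deck n) : 0 < card_number n i <= 2 * n.
Proof. by case: i => -[i lti] i_gt0; rewrite /card_number /= i_gt0 -ltnS. Qed.

Lemma card_number_out_shuffle n (i : deck n) :
  card_number n (out_shuffle n i) = out_shuffle_nat n (card_number n i).
Proof. by rewrite permE. Qed.

Lemma out_shuffle_halves n (i : deck n) :
  2 * (card_number n (out_shuffle n i)).-1 = (card_number n i).-1 %[mod 2 * n - 1].
Proof.
rewrite card_number_out_shuffle /out_shuffle_nat.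
have /andP[i_gt0 i_le] := card_number_bounds n i.
case: ifP => oddi; first by congr (_ %% _); lia.
(* For even [i] the sides differ by exactly one modulus: [2 * (i / 2 + n - 1) = (i - 1) + (2 * n -
   1)]. *)
by rewrite -[RHS]modnDr; congr (_ %% _); lia.
Qed.

Lemma out_shuffle_expg_halves n t (i : deck n) :
  2 ^ t * (card_number n ((out_shuffle n ^+ t)%g i)).-1
    = (card_number n i).-1 %[mod 2 * n - 1].
Proof.
elim: t => [|t IHt]; first by rewrite expg0 perm1 mul1n.
rewrite expgSr permM expnSr -mulnA -modnMmr out_shuffle_halves modnMmr.
exact: IHt.
Qed.

Lemma out_shuffle_expg_fix1 n t (i : deck n) :
  card_number n i = 1 -> (out_shuffle n ^+ t)%g i = i.
Proof.
move=> i1; elim: t => [|t IHt]; first by rewrite expg0 perm1.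
rewrite expgSr permM IHt; apply: card_number_inj.
by rewrite card_number_out_shuffle i1.
Qed.

Lemma deck_card n k : 0 < k <= 2 * n -> exists i : deck n, card_number n i = k.
Proof.
case/andP=> k_gt0; rewrite -ltnS => ltk.
by exists (Sub (Ordinal ltk) k_gt0).
Qed.

(** Without card 1 the predecessors run through [1, ..., 2n - 1], one for each residue class. *)
Lemma pred_mod_inj n a b : 1 < a <= 2 * n -> 1 < b <= 2 * n ->
  a.-1 = b.-1 %[mod 2 * n - 1] -> a = b.
Proof.
case: a b => [|[|a]] [|[|b]] //= a_le b_le /eqP.
(* Cancelling a further 1 brings both sides into [0, ..., 2n - 2], below the modulus. *)
rewrite -[a.+1]addn1 -[b.+1]addn1 eqn_modDr !modn_small; first by move/eqP->.
  by move: b_le; clear; lia.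
by move: a_le; clear; lia.
Qed.

Lemma out_shuffle_expg_eq1 n t : 0 < n ->
  (out_shuffle n ^+ t == 1)%g <-> 2 ^ t = 1 %[mod 2 * n - 1].
Proof.
move=> n_gt0; split=> [/eqP gt1 | pow1].
  have [|i i2] := @deck_card n 2; first by lia.
  by have := out_shuffle_expg_halves n t i; rewrite gt1 perm1 i2 muln1.
apply/eqP/permP=> i; rewrite perm1.
have [i1|i_neq1] := eqVneq (card_number n i) 1; first exact: out_shuffle_expg_fix1.
have := out_shuffle_expg_halves n t i; set j := (out_shuffle n ^+ t)%g i.
rewrite -modnMml pow1 modnMml mul1n => eq_ij.
have [j1|j_neq1] := eqVneq (card_number n j) 1.
  (* Here [j] is a fixed point of [g^t] and also the image of [i], so injectivity of [g^t] gives
     [j = i]. *)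
  by apply: (@perm_inj _ (out_shuffle n ^+ t)%g); apply: out_shuffle_expg_fix1.
have gt1 (k : deck n) : card_number n k != 1 -> 1 < card_number n k <= 2 * n.
  have /andP[k_gt0 ->] := card_number_bounds n k.
  by rewrite ltn_neqAle eq_sym k_gt0 andbT => ->.
by apply/card_number_inj/(@pred_mod_inj n); rewrite ?gt1.
Qed.

Theorem mainTheorem4 (n : nat) (n_ge1 : 1 <= n) :
  is_mod_order 2 (2 * n - 1) (period (out_shuffle n)).
Proof.
rewrite /period; case: ex_minnP => s /andP[s_gt0 gs1] s_min.
split=> [//||t t_gt0 pow1]; first exact/out_shuffle_expg_eq1.
by apply: s_min; rewrite t_gt0; apply/out_shuffle_expg_eq1.
Qed.
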